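(* Let $n\ge 4$ and let $\mathbb{B}_n$ be the set of strongly connected bicyclic digraphs of order $n$. Then, up to isomorphism, $\theta(1,1,n-4)$ is the unique digraph in $\mathbb{B}_n$ achieving the second minimum spectral radius among digraphs in $\mathbb{B}_n$, and $\theta(0,2,n-4)$ is the unique digraph in $\mathbb{B}_n$ achieving the third minimum spectral radius among digraphs in $\mathbb{B}_n$.
   Context: Digraphs have no loops and no multiple arcs (arcs $uv$ and $vu$ may both be present). The spectral radius $\rho(D)$ of a digraph $D$ is the largest modulus of an eigenvalue of its adjacency matrix $A(D)=(a_{ij})$, where $a_{ij}=1$ if there is an arc from $v_i$ to $v_j$ and $0$ otherwise. A digraph $D$ is strongly connected if for every ordered pair of vertices there is a directed path from the first to the second; it is a strongly connected bicyclic digraph if it is strongly connected and $|E(D)|=|V(D)|+1$. Let $P_m$ denote a directed path on $m$ vertices. For integers $0\le a\le b$, $c\ge 0$, the $\theta$-digraph $\theta(a,b,c)$ consists of three internally vertex-disjoint directed paths $P_{a+2}$, $P_{b+2}$, $P_{c+2}$ such that $P_{a+2}$ and $P_{b+2}$ both start at the terminal vertex of $P_{c+2}$ and both end at the initial vertex of $P_{c+2}$; it has order $a+b+c+2$. *)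

(* Defs.v *)
From HB Require Import structures.
From mathcomp Require Import all_boot all_order all_algebra.
From mathcomp Require Import reals.
From mathcomp Require Import complex.

Set Implicit Arguments.
Unset Strict Implicit.
Unset Printing Implicit Defensive.

Import Order.TTheory GRing.Theory Num.Theory.
Local Open Scope ring_scope.

Record digraph := Digraph {
  vertex :> finType;
  arc : rel vertex;
  arc_irr : irreflexive arc
}.

Definition num_arcs (D : digraph) : nat :=
  #|[set uv : D * D | arc uv.1 uv.2]|.

Definition strongly_connected (D : digraph) : Prop :=
  forall u v : D, connect (@arc D) u v.

Definition bicyclic (D : digraph) : Prop :=
  strongly_connected D /\ num_arcs D = #|D|.+1.

Definition bicyclic_of_order (n : nat) (D : digraph) : Prop :=
  #|D| = n /\ bicyclic D.

Definition isomorphic (D1 D2 : digraph) : Prop :=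
  exists2 f : D1 -> D2, bijective f & {mono f : u v / arc u v}.

(* The arcs of the directed path visiting the vertices of s in order. *)
Definition path_arcs (T : Type) (s : seq T) : seq (T * T) :=
  zip s (behead s).

(* theta(a, b, c) is carried by 0, ..., a + b + c + 1: vertex 0 is the terminal
   vertex of P_(c+2), vertex 1 is its initial vertex, and the three iota
   segments are the internal vertices of the three paths. *)
Definition theta_arcs (a b c : nat) : seq (nat * nat) :=
  path_arcs (0%N :: iota 2 a ++ [:: 1%N]) ++
  path_arcs (0%N :: iota (2 + a) b ++ [:: 1%N]) ++
  path_arcs (1%N :: iota (2 + a + b) c ++ [:: 0%N]).

Definition theta_arc (a b c : nat) : rel 'I_(a + b + c + 2) :=
  fun u v => (val u, val v) \in theta_arcs a b c.

Lemma path_arcs_irr (T : eqType) (s : seq T) (x : T) :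
  uniq s -> ((x, x) \in path_arcs s) = false.
Proof.
case: s => [|y s] //=; elim: s y => [|z s IHs] y //= /andP[ys us].
rewrite inE IHs // orbF xpair_eqE; apply/negbTE/negP.
by case/andP=> /eqP-> /eqP yz; rewrite yz inE eqxx in ys.
Qed.

Lemma theta_arc_irr a b c : irreflexive (@theta_arc a b c).
Proof.
move=> u; rewrite /theta_arc !mem_cat !path_arcs_irr //=;
  by rewrite ?mem_cat ?cats1 ?rcons_uniq ?mem_rcons ?inE ?mem_iota ?iota_uniq.
Qed.

(* Since arcs form a relation, the two parallel arcs of the case a = b = 0 are
   merged; theta a b c is the theta-digraph only for (a, b) <> (0, 0). *)
Definition theta (a b c : nat) : digraph := Digraph (@theta_arc_irr a b c).

Section Spectrum.
Variable R : realType.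

(* Complex eigenvalues, with algebraic multiplicity. *)
Definition eigenvalues (n : nat) (A : 'M[R[i]]_n) : seq R[i] :=
  sval (closed_field_poly_normal (char_poly A)).

Lemma mem_eigenvalues n (A : 'M[R[i]]_n) z :
  (z \in eigenvalues A) = eigenvalue A z.
Proof.
rewrite eigenvalue_root_char /eigenvalues.
case: closed_field_poly_normal => s /= ->.
by rewrite (monicP (char_poly_monic A)) scale1r root_prod_XsubC.
Qed.

Definition adjacency (D : digraph) : 'M[R[i]]_#|D| :=
  \matrix_(i, j) (arc (enum_val i) (enum_val j))%:R.

Definition spectral_radius (D : digraph) : R :=
  \big[Num.max/0]_(z <- eigenvalues (adjacency D)) ComplexField.Normc.normc z.

(* The default 0 of the maximum is harmless: moduli are nonnegative, and a
   nonempty digraph has an eigenvalue. *)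
Lemma spectral_radiusP (D : digraph) : (0 < #|D|)%N ->
  (exists2 z, eigenvalue (adjacency D) z &
              ComplexField.Normc.normc z = spectral_radius D) /\
  (forall z, eigenvalue (adjacency D) z ->
             ComplexField.Normc.normc z <= spectral_radius D).
Proof.
move=> D_gt0; split; last first.
  move=> z; rewrite -mem_eigenvalues /spectral_radius.
  by move=> zA; apply: le_bigmax_seq zA _.
have : eigenvalues (adjacency D) != [::].
  apply/eqP; rewrite /eigenvalues.
  case: closed_field_poly_normal => s /= Ds s0.
  have := size_char_poly (adjacency D).
  rewrite Ds s0 big_nil (monicP (char_poly_monic _)) scale1r size_poly1.
  by case=> D0; rewrite -D0 in D_gt0.
suff Hs s : s != [::] -> exists2 z : R[i], z \in s &
    ComplexField.Normc.normc z =
    \big[Num.max/0]_(z <- s) ComplexField.Normc.normc z.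
  by case/Hs=> z zA zE; exists z; rewrite // -mem_eigenvalues.
have normc_ge0 (z : R[i]) : 0 <= ComplexField.Normc.normc z.
  by case: z => x y; apply: sqrtr_ge0.
elim: s => [|x [|y s] IHs] // _.
  by exists x; rewrite ?mem_head // big_cons big_nil max_l.
have [z zs zE] := IHs isT; rewrite big_cons -zE.
case: (leP (ComplexField.Normc.normc z) (ComplexField.Normc.normc x)) => _.
  by exists x; rewrite ?mem_head.
by exists z; rewrite // inE zs orbT.
Qed.

(* r is the k-th smallest distinct value (k = 1, 2, ...) of S. *)
Definition kth_minimum (k : nat) (S : R -> Prop) (r : R) : Prop :=
  S r /\ exists s : seq R,
    [/\ uniq s, (size s).+1 = k & forall x, x \in s <-> S x /\ x < r].

Definition spectral_radii (n : nat) (r : R) : Prop :=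
  exists2 D : digraph, bicyclic_of_order n D & spectral_radius D = r.

Definition achieves_kth_minimum (n k : nat) (D : digraph) : Prop :=
  bicyclic_of_order n D /\
  kth_minimum k (spectral_radii n) (spectral_radius D).

Definition unique_kth_minimizer (n k : nat) (D : digraph) : Prop :=
  achieves_kth_minimum n k D /\
  forall D', achieves_kth_minimum n k D' -> isomorphic D' D.

End Spectrum.

(* Main.v *)
From mathcomp Require Import all_boot all_order all_algebra.
From mathcomp Require Import reals complex.
From mathcomp Require Import zify ring.
Require Import Defs.

(** In a strongly connected bicyclic digraph of order n all vertices but one,
    u, have a single out-neighbour, and u has two. Following the arcs from
    either out-neighbour of u leads back to u, which gives two cycles through
    u; let p and q be their lengths. An eigenvector x for z != 0 satisfies
    x_v = z^-d x_u when v is at distance d from u, so z is an eigenvalue iff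
    z^-p + z^-q = 1. Hence y = 1/rho is the root in ]0, 1[ of y^p + y^q = 1,
    and rho decreases when y^p + y^q decreases on ]0, 1[.

    The two cycles cover the n vertices and share at least u, so p, q <= n and
    p + q > n, and p = q = n is impossible. As they share p + q - n vertices,
    which form a common final path, n, p and q determine the digraph; for
    theta(a,b,c) they are a+b+c+2, a+c+2 and b+c+2. The smallest values of
    y^p + y^q are y^n + y^(n-1) < 2 y^(n-1) < y^n + y^(n-2), and any other pair
    (p, q) gives more; the infinity-digraphs, for which p + q = n + 1, are
    among those. *)

Set Implicit Arguments.
Unset Strict Implicit.
Unset Printing Implicit Defensive.

Import Order.TTheory GRing.Theory Num.Theory.

(* A strongly connected digraph with one more arc than vertices has exactly one
   vertex of outdegree 2, the branching vertex; [depth] is the distance to it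
   along [next]. The two cycles through [branching], of lengths p and q, start
   with the arcs to [start1] and [start2]; they merge at the latest in
   [branching], and share a longer path exactly when p + q > #|D| + 1. *)
Record two_cycles (D : digraph) (p q : nat) := TwoCycles {
  branching : D;
  start1 : D;
  start2 : D;
  next : D -> D;
  depth : D -> nat;
  start_neq : start1 != start2;
  arc_branching : arc branching =1 pred2 start1 start2;
  arc_next : forall v, v != branching -> arc v =1 pred1 (next v);
  depth_branching : depth branching = 0;
  depth_next : forall v, v != branching -> depth v = (depth (next v)).+1;
  depth_start1 : (depth start1).+1 = p;
  depth_start2 : (depth start2).+1 = q;
  entry : forall v, [|| v == start1, v == start2 |
                     [exists w, (w != branching) && (next w == v)]]
}.

Lemma two_cycles_sym D p q : two_cycles D p q -> two_cycles D q p.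
Proof.
case=> u w1 w2 s d neq au an du dn d1 d2 en.
apply: (@TwoCycles _ _ _ u w2 w1 s d) => //; first by rewrite eq_sym.
- by move=> v; rewrite au /= orbC.
- by move=> v; rewrite orbCA.
Qed.

(** * Paths to the branching vertex and their overlap *)

Section Branches.
Variables (D : digraph) (p q : nat) (T : two_cycles D p q).
Implicit Types v w : D.
Let u := branching T.
Let s := next T.
Let d := depth T.

Lemma depth_eq0 v : (d v == 0) = (v == u).
Proof.
have [->|/[dup] vu /depth_next /= dv] := eqVneq v u.
  by rewrite /d depth_branching.
by rewrite /d dv.
Qed.

Lemma depth_pred v : d (s v) = (d v).-1 \/ v = u.
Proof. by have [->|/depth_next /= dv] := eqVneq v u; [right|left; rewrite /d dv]. Qed.

Lemma depth_iter w k : k <= d w -> d (iter k s w) = d w - k.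
Proof.
elim: k => [|k IHk] kd /=; first by rewrite subn0.
have dk := IHk (ltnW kd).
have [->|/eqP] := depth_pred (iter k s w); first by rewrite dk subnS.
by rewrite -depth_eq0 dk subn_eq0 leqNgt kd.
Qed.

(* The vertex at depth k on the path from w to the branching vertex; junk for
   k > d w. *)
Definition branch w k := iter (d w - k) s w.

(** Each depth up to [d w] occurs exactly once on the path from [w], so a vertex lies on it iff it
    is the one found there at its own depth. Injectivity of depth on the path is then immediate. *)
Definition on_branch w : {set D} := [set v | (d v <= d w) && (branch w (d v) == v)].

Lemma depth_branch w k : k <= d w -> d (branch w k) = k.
Proof. by move=> kw; rewrite depth_iter ?leq_subr// subKn. Qed.

Lemma branch_on w k : k <= d w -> branch w k \in on_branch w.
Proof. by move=> kw; rewrite inE depth_branch // kw eqxx. Qed.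

Lemma branch_start w : branch w (d w) = w.
Proof. by rewrite /branch subnn. Qed.

Lemma start_on w : w \in on_branch w.
Proof. by rewrite inE leqnn branch_start eqxx. Qed.

Lemma branchS w k : k < d w -> branch w k = s (branch w k.+1).
Proof. by move=> kw; rewrite /branch -iterS -subSn // subSS. Qed.

Lemma on_branch_depth_inj w : {in on_branch w &, injective d}.
Proof.
move=> v v' /[!inE] /andP[_ /eqP v1] /andP[_ /eqP v2] vv'.
by rewrite -v1 -v2 vv'.
Qed.

Lemma on_branch_next w v : v != u -> v \in on_branch w -> s v \in on_branch w.
Proof.
move=> vu; rewrite inE => /andP[dv /eqP vE].
have dvS := depth_next vu; rewrite -/d -/s in dvS.
have dlt : d (s v) < d w by rewrite -dvS.
by rewrite -{1}vE dvS -branchS // branch_on // ltnW.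
Qed.

Lemma card_on_branch w : #|on_branch w| = (d w).+1.
Proof.
have -> : on_branch w = [set branch w k | k : 'I_(d w).+1].
  apply/setP => v; apply/idP/imsetP => [|[k _ ->]]; last first.
    by rewrite branch_on // -ltnS.
  rewrite inE => /andP[dv /eqP vE]; rewrite -ltnS in dv.
  by exists (Ordinal dv).
rewrite card_imset ?card_ord // => i j ij; apply: val_inj => /=.
by rewrite -(@depth_branch w i) -1?ltnS // ij depth_branch // -ltnS.
Qed.

(** By [entry], a vertex that is not a start is the [next] of a vertex one deeper. Going back in
    this way ends at a start because depth is bounded; hence the induction on the gap to the maximal
    depth. *)
Lemma on_branch_cover v : v \in on_branch (start1 T) :|: on_branch (start2 T).
Proof.
have [m] := ubnP ((\max_v d v) - d v); elim: m => // m IHm in v *.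
move=> dvm; rewrite inE.
case/or3P: (entry T v) => [/eqP->|/eqP->|/existsP[w /andP[wu /eqP wv]]].
- by rewrite start_on.
- by rewrite start_on orbT.
have dw := depth_next wu; rewrite wv -/d in dw.
have dM : d w <= \max_v d v by apply: leq_bigmax.
have /setUP[] : w \in on_branch (start1 T) :|: on_branch (start2 T).
- by apply: IHm; move: dvm dM; rewrite dw; lia.
- by move=> /(on_branch_next wu); rewrite /s wv => ->.
- by move=> /(on_branch_next wu); rewrite /s wv => ->; rewrite orbT.
Qed.

(** Branches are closed under [next], so two of them that meet stay together down to the branching
    vertex. *)
Lemma branch_common w w' k j : j <= k -> k <= d w ->
  branch w k \in on_branch w' -> branch w j \in on_branch w'.
Proof.
elim: k j => [|k IHk] j; first by rewrite leqn0 => /eqP->.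
rewrite leq_eqVlt => /predU1P[->//|jk] kw kw'; apply: IHk => //; first exact: ltnW.
rewrite branchS // on_branch_next // -depth_eq0 depth_branch //.
Qed.

(* Two branches agree below some depth and are disjoint from there on, so that
   depth is determined by the number of their common vertices. *)
Lemma mem_on_branch_lt w w' v : v \in on_branch w ->
  (v \in on_branch w') = (d v < #|on_branch w :&: on_branch w'|).
Proof.
move=> /[dup] vw; rewrite inE => /andP[dv /eqP vE].
have cardB k : k <= (d w).+1 -> #|[set branch w j | j : 'I_k]| = k.
  move=> kw; rewrite card_imset ?card_ord // => i j ij; apply: val_inj => /=.
  rewrite -(@depth_branch w i); last by rewrite -ltnS (leq_trans _ kw).
  by rewrite ij depth_branch // -ltnS (leq_trans _ kw).
apply/idP/idP => [vw'|].
  rewrite -(cardB (d v).+1) //; apply/subset_leq_card/subsetP => _ /imsetP[j _ ->].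
  rewrite inE branch_on ?(leq_trans _ dv) -1?ltnS //=.
  by apply: (@branch_common w w' (d v)); rewrite ?vE // -ltnS.
apply: contraLR => vw'; rewrite -leqNgt -[leqRHS](cardB (d v)) ?(leqW dv) //.
apply/subset_leq_card/subsetP => x; rewrite inE => /andP[xw xw'].
have dx : d x < d v.
  rewrite ltnNge; apply: contra vw' => vx.
  move: xw; rewrite inE => /andP[dx /eqP xE]; rewrite -vE.
  by apply: (@branch_common _ _ (d x)); rewrite ?xE.
apply/imsetP; exists (Ordinal dx) => //=.
by move: xw; rewrite inE => /andP[_ /eqP].
Qed.

(** Inclusion-exclusion: the branches have p and q vertices and cover [D]. *)
Lemma card_common : #|on_branch (start1 T) :&: on_branch (start2 T)| = p + q - #|D|.
Proof.
have := cardsUI (on_branch (start1 T)) (on_branch (start2 T)).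
have -> : on_branch (start1 T) :|: on_branch (start2 T) = setT.
  by apply/setP => v; rewrite on_branch_cover inE.
by rewrite !card_on_branch depth_start1 depth_start2 cardsT => <-; rewrite addKn.
Qed.

Lemma mem_branch2 v : v \in on_branch (start1 T) ->
  (v \in on_branch (start2 T)) = (d v < p + q - #|D|).
Proof. by move=> v1; rewrite (mem_on_branch_lt _ v1) card_common. Qed.

Lemma mem_branch1 v : v \in on_branch (start2 T) ->
  (v \in on_branch (start1 T)) = (d v < p + q - #|D|).
Proof. by move=> v1; rewrite (mem_on_branch_lt _ v1) setIC card_common. Qed.

Lemma branching_on w : u \in on_branch w.
Proof.
rewrite inE /d depth_branching leq0n /=.
rewrite -depth_eq0 depth_branch //.
Qed.

(** Lengths exceed 1 for lack of loops, and both branches contain the branching vertex. If p = q =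
    [#|D|], both starts would have the same depth on one branch, hence coincide. *)
Lemma two_cycles_bounds :
  [/\ 1 < p, 1 < q, p <= #|D| & q <= #|D|] /\
  #|D| < p + q /\ ~ (p = #|D| /\ q = #|D|).
Proof.
have d_gt0 w : arc u w -> 0 < d w.
  by move=> uw; rewrite lt0n depth_eq0; apply: contraTneq uw => ->; rewrite arc_irr.
have p1 : 1 < p by rewrite -(depth_start1 T) ltnS d_gt0 // arc_branching /= eqxx.
have q1 : 1 < q by rewrite -(depth_start2 T) ltnS d_gt0 // arc_branching /= eqxx orbT.
have pE := card_on_branch (start1 T); have qE := card_on_branch (start2 T).
rewrite /d depth_start1 in pE; rewrite /d depth_start2 in qE.
have pD : p <= #|D| by rewrite -pE max_card.
have qD : q <= #|D| by rewrite -qE max_card.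
split=> //; split.
  by rewrite -subn_gt0 -card_common card_gt0; apply/set0Pn; exists u; rewrite inE !branching_on.
case=> pD' qD'.
have /eqP : start1 T = start2 T; last by rewrite (negPf (start_neq T)).
apply: (@on_branch_depth_inj (start1 T)); rewrite ?start_on //.
  rewrite mem_branch1 ?start_on // -ltnS depth_start2.
  by lia.
apply: succn_inj; rewrite /d depth_start1 depth_start2; congruence.
Qed.

End Branches.

(** * Order and cycle lengths determine the digraph *)

Definition transfer p q D D' (T : two_cycles D p q) (T' : two_cycles D' p q) v :=
  if v \in on_branch T (start1 T) then branch T' (start1 T') (depth T v)
  else branch T' (start2 T') (depth T v).

Section Isomorphism.
Variables (p q : nat).

Lemma start1_same D D' (T : two_cycles D p q) (T' : two_cycles D' p q) :
  depth T (start1 T) = depth T' (start1 T').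
Proof. by apply: succn_inj; rewrite !depth_start1. Qed.

Lemma start2_same D D' (T : two_cycles D p q) (T' : two_cycles D' p q) :
  depth T (start2 T) = depth T' (start2 T').
Proof. by apply: succn_inj; rewrite !depth_start2. Qed.

(** The common vertices are those of depth below [p + q - #|D|], a bound shared by both digraphs. So
    common vertices go to common vertices, and the preference of [transfer] for the first branch is
    harmless. *)
Lemma transferP D D' (T : two_cycles D p q) (T' : two_cycles D' p q) v :
  #|D| = #|D'| ->
  [/\ depth T' (transfer T T' v) = depth T v,
      (transfer T T' v \in on_branch T' (start1 T')) = (v \in on_branch T (start1 T)) &
      (transfer T T' v \in on_branch T' (start2 T')) = (v \in on_branch T (start2 T))].
Proof.
move=> DD'; rewrite /transfer; case: ifPn => v1.
  have d1 : depth T v <= depth T' (start1 T').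
    by rewrite -(start1_same T); move: v1; rewrite inE => /andP[].
  have v1' := branch_on d1.
  by rewrite v1' depth_branch // mem_branch2 // mem_branch2 // depth_branch // DD'.
have v2 : v \in on_branch T (start2 T).
  by have := on_branch_cover T v; rewrite inE (negPf v1).
have d2 : depth T v <= depth T' (start2 T').
  by rewrite -(start2_same T); move: v2; rewrite inE => /andP[].
have v2' := branch_on d2.
rewrite v2' v2 depth_branch // mem_branch1 // depth_branch // -DD'.
by rewrite -(mem_branch1 v2) (negPf v1).
Qed.

Lemma branch_depth_inj D (T : two_cycles D p q) v v' :
  depth T v = depth T v' ->
  (v \in on_branch T (start1 T)) = (v' \in on_branch T (start1 T)) ->
  (v \in on_branch T (start2 T)) = (v' \in on_branch T (start2 T)) -> v = v'.
Proof.
move=> dd; have := on_branch_cover T v; rewrite inE.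
case/orP=> vb; rewrite vb => b1 b2.
  exact: (on_branch_depth_inj vb (esym b1) dd).
exact: (on_branch_depth_inj vb (esym b2) dd).
Qed.

(** Both transfers preserve depth and membership in each branch, and these data identify a
    vertex. *)
Lemma transferK D D' (T : two_cycles D p q) (T' : two_cycles D' p q) :
  #|D| = #|D'| -> cancel (transfer T T') (transfer T' T).
Proof.
move=> DD' v.
have [d1 b1 c1] := transferP T T' v DD'.
have [d2 b2 c2] := transferP T' T (transfer T T' v) (esym DD').
by apply: (@branch_depth_inj _ T); congruence.
Qed.

Lemma transfer_arc D D' (T : two_cycles D p q) (T' : two_cycles D' p q) v w :
  #|D| = #|D'| -> arc v w -> arc (transfer T T' v) (transfer T T' w).
Proof.
move=> DD'; have [d1 b1 c1] := transferP T T' v DD'.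
have [d2 b2 c2] := transferP T T' w DD'.
have [vu|vu] := eqVneq v (branching T).
  have -> : transfer T T' v = branching T'.
    by apply/eqP; rewrite -depth_eq0 d1 vu depth_branching.
  rewrite vu !arc_branching /= => /orP[]/eqP wE; apply/orP; [left|right]; apply/eqP.
    apply: (@on_branch_depth_inj _ _ _ T' (start1 T')); rewrite ?start_on //.
      by rewrite b2 wE start_on.
    by rewrite d2 wE; exact: start1_same.
  apply: (@on_branch_depth_inj _ _ _ T' (start2 T')); rewrite ?start_on //.
    by rewrite c2 wE start_on.
  by rewrite d2 wE; exact: start2_same.
have v'u : transfer T T' v != branching T' by rewrite -depth_eq0 d1 depth_eq0.
rewrite (arc_next vu) (arc_next v'u) /= => /eqP wE; apply/eqP.
have dd : depth T' (transfer T T' w) = depth T' (next T' (transfer T T' v)).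
  by apply: succn_inj; rewrite -(depth_next v'u) d1 d2 wE (depth_next vu).
have := on_branch_cover T v; rewrite inE => /orP[] vb.
  apply: (@on_branch_depth_inj _ _ _ T' (start1 T')) => //.
    by rewrite b2 wE on_branch_next.
  by rewrite on_branch_next // b1.
apply: (@on_branch_depth_inj _ _ _ T' (start2 T')) => //.
  by rewrite c2 wE on_branch_next.
by rewrite on_branch_next // c1.
Qed.

Lemma two_cycles_isomorphic D D' (T : two_cycles D p q) (T' : two_cycles D' p q) :
  #|D| = #|D'| -> isomorphic D D'.
Proof.
move=> DD'; exists (transfer T T').
  by exists (transfer T' T); apply: transferK.
(* The inverse is a transfer too, so reflection of arcs follows from preservation. *)
move=> v w; apply/idP/idP; last exact: transfer_arc.
rewrite -{2}(transferK T T' DD' v) -{2}(transferK T T' DD' w).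
exact: transfer_arc.
Qed.

End Isomorphism.

(** * Bicyclic digraphs as pairs of cycles *)

Lemma num_arcs_sum (D : digraph) : num_arcs D = \sum_(v : D) #|arc v|.
Proof.
rewrite /num_arcs cardsE -sum1_card.
rewrite (eq_bigr (fun v => \sum_(w | arc v w) 1)); last by move=> v _; rewrite -sum1_card.
by rewrite pair_big_dep.
Qed.

Lemma strongly_connected_outdeg_gt0 (D : digraph) (v : D) :
  strongly_connected D -> 1 < #|D| -> 0 < #|arc v|.
Proof.
move=> scD D1.
have [w vw] : exists w, w != v.
  have /card_gt0P[w] : 0 < #|predC1 v| by rewrite cardC1; lia.
  by exists w.
have /connectP[[|x r] /= ] := scD v w; first by move=> _ wv; rewrite wv eqxx in vw.
by case/andP=> vx _ _; apply/card_gt0P; exists x.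
Qed.

Lemma bicyclic_two_cycles D : bicyclic D -> 1 < #|D| ->
  exists p q, inhabited (two_cycles D p q).
Proof.
case=> scD mD D1; rewrite num_arcs_sum in mD.
have deg_gt0 v := strongly_connected_outdeg_gt0 v scD D1.
(* The outdegrees exceed 1 by a total of 1. Applied to [[set u]] and [[set v; u]], this leaves a
   single vertex of outdegree 2. *)
have sumE (E : {set D}) : \sum_(v in E) (#|arc v| - 1) <= 1.
  suff : \sum_(v : D) (#|arc v| - 1) = 1.
    move=> {2}<-; rewrite big_mkcond leq_sum // => v _.
    by case: ifP.
  have : \sum_(v : D) #|arc v| = \sum_(v : D) (#|arc v| - 1) + \sum_(v : D) 1.
    by rewrite -big_split; apply: eq_bigr => v _ /=; rewrite subnK.
  rewrite mD sum1_card; have -> : #|[pred v : D | true]| = #|D| by apply: eq_card.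
  by lia.
have [u u1] : exists u : D, 1 < #|arc u|.
  apply/existsP; apply/contraT; rewrite negb_exists => /forallP no.
  have : \sum_(v : D) #|arc v| = \sum_(v : D) 1.
    by apply: eq_bigr => v _; apply/eqP; rewrite eqn_leq deg_gt0 leqNgt no.
  rewrite mD sum1_card; have -> : #|[pred v : D | true]| = #|D| by apply: eq_card.
  by lia.
have u2 : #|arc u| = 2.
  by have := sumE [set u]; rewrite big_set1; lia.
have deg1 v : v != u -> #|arc v| = 1.
  move=> vu; have := sumE [set v; u].
  by rewrite big_setU1 ?inE //= big_set1; have := deg_gt0 v; lia.
have /cards2P[w1 [w2 [w12 uE]]] : #|[set w | arc u w]| == 2 by rewrite cardsE u2.
have auE : arc u =1 pred2 w1 w2.
  by move=> w; have := congr1 (fun A : {set D} => w \in A) uE; rewrite /= !inE.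
(* All outdegrees are positive, so [pick] succeeds; at [u] it selects one of the two
   out-neighbours. *)
pose s (v : D) := odflt v [pick w | arc v w].
have anE (v : D) : v != u -> arc v =1 pred1 (s v).
  move=> /deg1/eqP; rewrite -cardsE => /cards1P[x vE].
  have vx w : arc v w = (w == x).
    by have := congr1 (fun A : {set D} => w \in A) vE; rewrite /= !inE.
  rewrite /s; case: pickP => [y | /(_ x)]; last by rewrite vx eqxx.
  by rewrite vx => /eqP-> w; rewrite vx.
(* A path to [u] is forced to follow [s] until it first meets [u]. *)
have reach (v : D) : exists k, iter k s v == u.
  have /connectP[r] := scD v u; elim: r v => [|x r IHr] v /=.
    by move=> _ ->; exists 0.
  have [->|vu] := eqVneq v u; first by exists 0 => /=.
  rewrite (anE _ vu) => /andP[/eqP-> rp] ru.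
  by have [k kE] := IHr _ rp ru; exists k.+1; rewrite iterSr.
pose d v := ex_minn (reach v).
have du : d u = 0.
  by rewrite /d; case: ex_minnP => m _ /(_ 0); rewrite /= eqxx leqn0 => /(_ isT)/eqP.
have dn v : v != u -> d v = (d (s v)).+1.
  rewrite /d => vu; case: ex_minnP => m mu mmin; case: ex_minnP => k ku kmin.
  apply/eqP; rewrite eqn_leq mmin ?iterSr //=.
  case: m mu {mmin} => [|m]; first by rewrite /= (negPf vu).
  by rewrite iterSr => /kmin.
exists (d w1).+1, (d w2).+1; constructor.
apply: (@TwoCycles _ _ _ u w1 w2 s d) => // v.
(* The last arc of a path into [v] from another vertex gives an in-neighbour; if that is [u], then
   [v] is a start. *)
have [x xv] : exists x, arc x v.
  have [x vx] : exists x, x != v.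
    have /card_gt0P[w] : 0 < #|predC1 v| by rewrite cardC1; lia.
    by exists w.
  have /connectP[r] := scD x v; case/lastP: r => [|r y] /=.
    by move=> _ vE; rewrite vE eqxx in vx.
  by rewrite rcons_path last_rcons => /andP[_ ay] ->; exists (last x r).
have [xu|xu] := eqVneq x u.
  by move: xv; rewrite xu auE /= => /orP[]->; rewrite ?orbT.
apply/or3P; apply: Or33; apply/existsP; exists x; rewrite xu /=.
by rewrite (anE _ xu) /= in xv; rewrite eq_sym.
Qed.

(** This converse places the theta-digraphs among the bicyclic ones. Every vertex descends to the
    branching vertex along [next] and is reached from it by [entry]; the outdegrees are 2 once and 1
    elsewhere. *)
Lemma two_cycles_bicyclic D p q : two_cycles D p q -> bicyclic D.
Proof.
move=> T; split.
  have next_connect v : v != branching T -> connect (@arc D) v (next T v).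
    by move=> vu; apply: connect1; rewrite (arc_next vu) /=.
  have to_u v : connect (@arc D) v (branching T).
    have [m dm] := ubnP (depth T v); elim: m => // m IHm in v dm *.
    have [->|vu] := eqVneq v (branching T); first exact: connect0.
    apply: connect_trans (next_connect _ vu) (IHm _ _).
    by rewrite (depth_next vu) in dm.
  have from_u v : connect (@arc D) (branching T) v.
    have [m] := ubnP ((\max_w depth T w) - depth T v).
    elim: m => // m IHm in v *; move=> dm.
    case/or3P: (entry T v) => [/eqP->|/eqP->|/existsP[w /andP[wu /eqP wv]]].
    - by apply: connect1; rewrite arc_branching /= eqxx.
    - by apply: connect1; rewrite arc_branching /= eqxx orbT.
    have dw := depth_next wu; rewrite wv in dw.
    have dM : depth T w <= \max_w depth T w by apply: leq_bigmax.
    rewrite -wv; apply: connect_trans (IHm w _) (next_connect _ wu).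
    by move: dm dM; rewrite dw; lia.
  by move=> v w; apply: connect_trans (to_u v) (from_u w).
rewrite num_arcs_sum (bigD1 (branching T)) //= (eq_card (arc_branching T)).
rewrite card2 start_neq (eq_bigr (fun=> 1)) => [|v vu]; last first.
  by rewrite (eq_card (arc_next vu)) card1.
rewrite sum1_card cardC1.
have : 0 < #|D| by apply/card_gt0P; exists (branching T).
by case: #|D|.
Qed.

(** * Eigenvalues and the spectral radius *)

Section Spectrum.
Local Open Scope ring_scope.

(** [eigenvalue] is defined by row vectors; transposing allows eigenvectors that sum over
    out-neighbours. *)
Lemma eigenvalue_trmx (F : fieldType) n (A : 'M[F]_n) : eigenvalue A^T =1 eigenvalue A.
Proof.
move=> z; rewrite !eigenvalue_root_char /char_poly -[in RHS]det_tr; congr (root (\det _) z).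
by apply/matrixP=> i j; rewrite !mxE eq_sym.
Qed.

Variable R : realType.

Lemma adjacency_eigenvalueP (D : digraph) (z : R[i]) :
  reflect (exists2 x : D -> R[i],
             forall v, \sum_(w | arc v w) x w = z * x v & exists v, x v != 0)
          (eigenvalue (adjacency R D) z).
Proof.
rewrite -eigenvalue_trmx; apply: (iffP eigenvalueP) => [[y yE y0]|[x xE [v xv]]].
  exists (fun v => y 0 (enum_rank v)) => [v|].
    have /matrixP/(_ 0 (enum_rank v)) := yE; rewrite !mxE => <-.
    rewrite (reindex (@enum_rank D)) /=; last first.
      by exists enum_val => i _; rewrite ?enum_rankK ?enum_valK.
    rewrite big_mkcond; apply: eq_bigr => w _; rewrite !mxE !enum_rankK.
    by case: arc; rewrite ?mulr1 ?mulr0.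
  apply/existsP; apply: contraNT y0; rewrite negb_exists => /forallP y0.
  apply/eqP/rowP => i; have := y0 (enum_val i).
  by rewrite negbK enum_valK mxE => /eqP.
exists (\row_i x (enum_val i)); last first.
  apply: contraNneq xv => /rowP/(_ (enum_rank v)).
  by rewrite !mxE enum_rankK => ->.
apply/rowP => i; rewrite !mxE -xE (reindex (@enum_rank D)) /=; last first.
  by exists enum_val => j _; rewrite ?enum_rankK ?enum_valK.
rewrite [RHS]big_mkcond; apply: eq_bigr => w _; rewrite !mxE !enum_rankK.
by case: arc; rewrite ?mulr1 ?mulr0.
Qed.

Lemma two_cycles_eigenvalue D p q (T : two_cycles D p q) (z : R[i]) : z != 0 ->
  eigenvalue (adjacency R D) z = (z^-1 ^+ p + z^-1 ^+ q == 1).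
Proof.
move=> z0; have w12 := start_neq T.
have sum_u (x : D -> R[i]) :
    \sum_(w | arc (branching T) w) x w = x (start1 T) + x (start2 T).
  rewrite (eq_bigl _ _ (arc_branching T)) (bigD1 (start1 T)) /= ?eqxx //.
  congr (_ + _); rewrite -(big_pred1_eq +%R (start2 T) x).
  apply: eq_bigl => w /=; have [->|] := eqVneq w (start1 T); last by rewrite andbT.
  by rewrite andbF (negPf w12).
have sum_n (x : D -> R[i]) v : v != branching T ->
    \sum_(w | arc v w) x w = x (next T v).
  by move=> vu; rewrite (eq_bigl _ _ (arc_next vu)) big_pred1_eq.
apply/adjacency_eigenvalueP/eqP => [[x xE [v xv]]|zpq].
  have xd w : x w = z^-1 ^+ depth T w * x (branching T).
    have [m dm] := ubnP (depth T w); elim: m => // m IHm in w dm *.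
    have [->|wu] := eqVneq w (branching T); first by rewrite depth_branching mul1r.
    rewrite (depth_next wu) exprS -mulrA -IHm; last by rewrite (depth_next wu) in dm.
    by rewrite -(sum_n _ _ wu) xE mulKf.
  have xu0 : x (branching T) != 0.
    by apply: contraNneq xv => xu; rewrite xd xu mulr0.
  (* Multiplying the equation at the branching vertex by [z^-1] turns the depths of the starts into
     the cycle lengths. *)
  have := xE (branching T); rewrite sum_u (xd (start1 T)) (xd (start2 T)) => /(congr1 (fun y => z^-1 * y)).
  rewrite mulKf // mulrDr !mulrA -!exprS depth_start1 depth_start2 -mulrDl.
  rewrite -[RHS]mul1r.
  exact: mulIf.
exists (fun w => z^-1 ^+ depth T w); last first.
  by exists (branching T); rewrite expf_neq0 ?invr_neq0.
move=> v; have [->|vu] := eqVneq v (branching T).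
  rewrite sum_u depth_branching mulr1; apply: (mulfI (invr_neq0 z0)).
  by rewrite mulVf // mulrDr -!exprS depth_start1 depth_start2.
by rewrite sum_n // (depth_next vu) exprS mulVKf.
Qed.

Lemma lt_sum_expr (F : realFieldType) p q (x y : F) : (0 < p)%N -> (0 < q)%N ->
  0 <= x -> x < y -> x ^+ p + x ^+ q < y ^+ p + y ^+ q.
Proof.
move=> p0 q0 x0 xy.
by rewrite ltrD // ltrXn2r ?gtn_eqF.
Qed.

Lemma sum_expr_root p q : (0 < p)%N -> (0 < q)%N ->
  exists2 y : R, 0 < y < 1 & y ^+ p + y ^+ q = 1.
Proof.
move=> p0 q0; pose P : {poly R} := 'X^p + 'X^q - 1.
have PE y : P.[y] = y ^+ p + y ^+ q - 1 by rewrite /P !hornerE.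
have P0 : P.[0] = -1 by rewrite PE !expr0n !gtn_eqF //= !add0r.
have P1 : P.[1] = 1 by rewrite PE !expr1n addrK.
have [|y] := polyrcf.poly_ivtoo (@ler01 R) (p := P); first by rewrite P0 P1 mulr1 ltrN10.
rewrite in_itv /= => y01 /rootP; rewrite PE => /eqP; rewrite subr_eq0 => /eqP yE.
by exists y.
Qed.

(** For the real root [y], [y^-1] is itself an eigenvalue, and the triangle inequality excludes any
    of larger modulus. *)
Lemma spectral_radius_root D p q (T : two_cycles D p q) :
  let y := (spectral_radius R D)^-1 in 0 < y < 1 /\ y ^+ p + y ^+ q = 1.
Proof.
have [[p1 q1 _ _] _] := two_cycles_bounds T.
have p0 := ltnW p1; have q0 := ltnW q1.
have [y /andP[y0 y1] yE] := sum_expr_root p0 q0.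
suff -> : spectral_radius R D = y^-1 by rewrite invrK; split => //; apply/andP.
have D0 : (0 < #|D|)%N by apply/card_gt0P; exists (branching T).
have [[z zA <-] maxA] := spectral_radiusP R D0.
have normcX (x : R[i]) n : ComplexField.Normc.normc (x ^+ n) = ComplexField.Normc.normc x ^+ n.
  elim: n => [|n IHn]; first by rewrite !expr0 ComplexField.Normc.normc1.
  by rewrite !exprS ComplexField.Normc.normcM IHn.
have normc_real (x : R) : 0 <= x -> ComplexField.Normc.normc x%:C%C = x.
  by move=> x0; rewrite /= expr0n /= addr0 sqrtr_sqr ger0_norm.
have yz : y^-1 <= ComplexField.Normc.normc z.
  have yV0 : (y^-1)%:C%C != 0 :> R[i].
    by rewrite -[0]/(0%:C%C) (inj_eq (@complexI R)) invr_eq0 gt_eqF.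
  rewrite -[leLHS]normc_real; last by rewrite invr_ge0 ltW.
  apply: maxA; rewrite (two_cycles_eigenvalue T yV0) -fmorphV invrK -!rmorphXn -rmorphD /=.
  by rewrite yE rmorph1.
(* If |z| > 1/y, then 1 = |z^-p + z^-q| <= |z|^-p + |z|^-q < y^p + y^q = 1. *)
apply/eqP; rewrite eq_le yz andbT leNgt; apply/negP => zy.
have z0 : z != 0.
  apply: contraTneq zy => ->; rewrite ComplexField.Normc.normc0.
  by rewrite -leNgt invr_ge0 ltW.
have := zA; rewrite (two_cycles_eigenvalue T z0) => /eqP/(congr1 (@ComplexField.Normc.normc R)).
rewrite ComplexField.Normc.normc1 => zE.
have := le_normcD (z^-1 ^+ p) (z^-1 ^+ q).
rewrite zE !normcX ComplexField.Normc.normcV -yE leNgt lt_sum_expr //.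
  by rewrite invr_ge0 (le_trans _ yz) // invr_ge0 ltW.
have nz : 0 < ComplexField.Normc.normc z by rewrite (lt_trans _ zy) ?invr_gt0.
by rewrite invf_plt.
Qed.
End Spectrum.

(** * The cycles of the theta-digraphs *)

Section Theta.
Variables a b c : nat.
Hypothesis ab_gt0 : 0 < a + b.
Local Notation N := (a + b + c + 2).

(* The vertex 0 of [theta a b c] is the branching one, so [theta_next 0] is junk. *)
Definition theta_start1 := if a == 0 then 1 else 2.

Definition theta_start2 := if b == 0 then 1 else 2 + a.

Definition theta_next (v : nat) :=
  if v == 1 then if c == 0 then 0 else 2 + a + b
  else if v < 2 + a then if v.+1 == 2 + a then 1 else v.+1
  else if v < 2 + a + b then if v.+1 == 2 + a + b then 1 else v.+1
  else if v.+1 == 2 + a + b + c then 0 else v.+1.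

Definition theta_prev (v : nat) :=
  if v == 0 then if c == 0 then 1 else a + b + c + 1
  else if v == 1 then 1 + a
  else if v == 2 + a + b then 1
  else v.-1.

(** Internal vertices of the first two paths reach 0 through vertex 1, whose depth is [c.+1]. *)
Definition theta_depth (v : nat) :=
  if v == 0 then 0
  else if v == 1 then c.+1
  else if v < 2 + a then c + 1 + (2 + a - v)
  else if v < 2 + a + b then c + 1 + (2 + a + b - v)
  else 2 + a + b + c - v.

(** This turns arcs into linear arithmetic: the first disjunct is the arc leaving [u], the second
    the arcs leaving internal vertices. *)
Lemma mem_path_arcs_iota u m k w x y :
  ((x, y) \in path_arcs (u :: iota m k ++ [:: w])) =
  (x == u) && (y == if k == 0 then w else m) ||
  [&& m <= x, x < m + k & y == if x.+1 == m + k then w else x.+1].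
Proof.
elim: k u m => [|k IHk] u m /=.
  by rewrite /path_arcs /= inE xpair_eqE addn0; lia.
have -> : path_arcs (u :: m :: iota m.+1 k ++ [:: w]) =
  (u, m) :: path_arcs (m :: iota m.+1 k ++ [:: w]) by [].
rewrite inE IHk xpair_eqE.
by do ?[case: ifPn => ?]; lia.
Qed.

Lemma theta_arcE (v w : theta a b c) : arc v w =
  if val v == 0 then (val w == theta_start1) || (val w == theta_start2)
  else val w == theta_next v.
Proof.
rewrite /= /theta_arc /theta_arcs !mem_cat !mem_path_arcs_iota /theta_start1 /theta_start2.
have := ltn_ord v; have := ltn_ord w; rewrite /theta_next /=.
by do ?[case: ifPn => ?]; lia.
Qed.

(** The assumption [0 < a + b] separates the two starts, which would both be vertex 1 for a = b =
    0. *)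
Lemma theta_two_cycles : inhabited (two_cycles (theta a b c) (a + c + 2) (b + c + 2)).
Proof.
have N0 : 0 < N by lia.
have lt1 : theta_start1 < N by rewrite /theta_start1; case: ifP; lia.
have lt2 : theta_start2 < N by rewrite /theta_start2; case: ifP; lia.
have ltn (v : 'I_N) : theta_next v < N.
  have := ltn_ord v; rewrite /theta_next.
  by do ?[case: ifPn => ?]; lia.
have ltp (v : 'I_N) : theta_prev v < N.
  have := ltn_ord v; rewrite /theta_prev.
  by do ?[case: ifPn => ?]; lia.
have neq0 (v : 'I_N) : (v != Ordinal N0) = (val v != 0) by [].
constructor; apply: (@TwoCycles (theta a b c) _ _ (Ordinal N0) (Ordinal lt1) (Ordinal lt2)
  (fun v => Ordinal (ltn v)) (fun v : 'I_N => theta_depth v)) => //.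
- rewrite -val_eqE /= /theta_start1 /theta_start2.
  by do ?[case: ifPn => ?]; lia.
- by move=> w; rewrite theta_arcE.
- by move=> v; rewrite neq0 => v0 w; rewrite theta_arcE (negPf v0).
- move=> v; rewrite neq0 /=; have := ltn_ord v; rewrite /theta_next.
  by do ?[case: ifPn => ?]; rewrite /theta_depth /=; do ?[case: ifPn => ?]; lia.
- rewrite /= /theta_start1.
  by case: ifPn => ?; rewrite /theta_depth /=; do ?[case: ifPn => ?]; lia.
- rewrite /= /theta_start2.
  by case: ifPn => ?; rewrite /theta_depth /=; do ?[case: ifPn => ?]; lia.
move=> v; have [v1|v1] := eqVneq (val v) theta_start1; first by apply/or3P/Or31/eqP/val_inj.
have [v2|v2] := eqVneq (val v) theta_start2; first by apply/or3P/Or32/eqP/val_inj.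
apply/or3P/Or33/existsP; exists (Ordinal (ltp v)); rewrite neq0 -val_eqE /=.
move: v1 v2; have := ltn_ord v; rewrite /theta_start1 /theta_start2 /theta_prev.
by do ?[case: ifPn => ?]; rewrite /theta_next /=; do ?[case: ifPn => ?]; lia.
Qed.

End Theta.

Lemma card_theta a b c : #|theta a b c| = a + b + c + 2.
Proof. exact: card_ord. Qed.

(** * Comparing and ranking spectral radii *)

Section Comparison.
Local Open Scope ring_scope.
Variable R : realType.

(** At y = 1/rho(D) the sum for p', q' exceeds 1, its value at y' = 1/rho(D'); as that sum is
    increasing, y' < y. *)
Lemma spectral_radius_lt D D' p q p' q' (T : two_cycles D p q) (T' : two_cycles D' p' q') :
  (forall y : R, 0 < y < 1 -> y ^+ p + y ^+ q < y ^+ p' + y ^+ q') ->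
  spectral_radius R D < spectral_radius R D'.
Proof.
move=> lt_pq; have [] := spectral_radius_root R T; have [] := spectral_radius_root R T'.
set y := (spectral_radius R D)^-1; set y' := (spectral_radius R D')^-1.
move=> y'01 y'E y01 yE.
have [/andP[y'0 _] /andP[y0 _]] := (y'01, y01).
suff : y' < y by rewrite ltf_pV2 // posrE -invr_gt0.
rewrite ltNge; apply/negP => yy'.
have [[p1 q1 _ _] _] := two_cycles_bounds T'.
have := lt_pq y y01; rewrite yE -y'E ltNge lerD //;
  by rewrite lerXn2r // nnegrE ltW.
Qed.

Lemma spectral_radius_eq D D' p q (T : two_cycles D p q) (T' : two_cycles D' p q) :
  spectral_radius R D = spectral_radius R D'.
Proof.
have [] := spectral_radius_root R T; have [] := spectral_radius_root R T'.
set y := (spectral_radius R D)^-1; set y' := (spectral_radius R D')^-1.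
move=> /andP[y'0 _] y'E /andP[y0 _] yE.
have [[p1 q1 _ _] _] := two_cycles_bounds T'.
have p0 := ltnW p1; have q0 := ltnW q1.
apply: invr_inj; rewrite -/y -/y'; case: (ltgtP y y') => // yy'.
  by have := lt_sum_expr p0 q0 (ltW y0) yy'; rewrite yE y'E ltxx.
by have := lt_sum_expr p0 q0 (ltW y'0) yy'; rewrite yE y'E ltxx.
Qed.

(** If x < x', the list of values below x' contains x and all values below x, so it is too long. *)
Lemma kth_minimum_inj k (S : R -> Prop) r r' :
  kth_minimum k S r -> kth_minimum k S r' -> r = r'.
Proof.
have le_kth x x' : kth_minimum k S x -> kth_minimum k S x' -> x' <= x.
  move=> [Sx [s [us ks sP]]] [_ [s' [us' ks' s'P]]]; rewrite leNgt; apply/negP => xx'.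
  have : {subset x :: s <= s'}.
    move=> z; rewrite inE => /predU1P[->|/sP[Sz zx]]; apply/s'P; split=> //.
    exact: lt_trans xx'.
  have xs : x \notin s by apply/negP => /sP[]; rewrite ltxx.
  move=> /uniq_leq_size; rewrite /= xs us => /(_ isT).
  by rewrite ks -ks' ltnn.
by move=> kr kr'; apply/eqP; rewrite eq_le !le_kth.
Qed.

Lemma kth_minimum_first_three (S : R -> Prop) r1 r2 r3 : S r1 -> S r2 -> S r3 ->
    r1 < r2 -> r2 < r3 ->
    (forall x, S x -> [\/ x = r1, x = r2, x = r3 | r3 < x]) ->
  kth_minimum 2 S r2 /\ kth_minimum 3 S r3.
Proof.
move=> S1 S2 S3 lt12 lt23 cases; split; split=> //.
  exists [:: r1]; split=> // x; rewrite inE; split=> [/eqP->//|[/cases]].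
  case=> [->//|->|->|lt3]; rewrite ?ltxx // => lt2; first by rewrite ltNge (ltW lt23) in lt2.
  by have := lt_trans lt23 (lt_trans lt3 lt2); rewrite ltxx.
exists [:: r1; r2]; split=> [|//|x]; first by rewrite /= inE andbT lt_eqF.
rewrite !inE; split=> [/orP[]/eqP->|[/cases]]; [|by []|].
  by split=> //; apply: lt_trans lt23.
case=> [->|->|->|lt3]; rewrite ?ltxx ?eqxx ?orbT // => /(lt_trans lt3).
by rewrite ltxx.
Qed.

(* The first three cases are the cycle lengths of theta(0,1,n-3), theta(1,1,n-4)
   and theta(0,2,n-4). *)
Lemma bicyclic_cases n D : (4 <= n)%N -> bicyclic_of_order n D ->
  [\/ inhabited (two_cycles D n n.-1), inhabited (two_cycles D n.-1 n.-1),
      inhabited (two_cycles D n n.-2) |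
      exists p q, inhabited (two_cycles D p q) /\
        forall y : R, 0 < y < 1 -> y ^+ n + y ^+ n.-2 < y ^+ p + y ^+ q].
Proof.
move=> n4 [Dn bD].
have [|p [q [T]]] := bicyclic_two_cycles bD; first by rewrite Dn; lia.
(* The conclusion does not mention p and q, so the cycles may be swapped. *)
wlog pq : p q T / (q <= p)%N.
  move=> th; have [/th|/ltnW/th] := leqP q p; first exact.
  by apply; apply: two_cycles_sym.
have [[p1 q1 pn qn] [pqn nn]] := two_cycles_bounds T; rewrite Dn in pn qn pqn nn.
have expl (y : R) i j : 0 < y < 1 -> (i <= j)%N -> y ^+ j <= y ^+ i.
  by case/andP=> y0 y1 ij; rewrite ler_iXn2l.
have explt (y : R) i j : 0 < y < 1 -> (i < j)%N -> y ^+ j < y ^+ i.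
  by case/andP=> y0 y1 ij; rewrite ltr_iXn2l.
have [pE|pE] := eqVneq p n.
  have [qE|qE] := eqVneq q n.-1; first by apply: Or41; constructor; move: T; rewrite pE qE.
  have [qE'|qE'] := eqVneq q n.-2; first by apply: Or43; constructor; move: T; rewrite pE qE'.
  apply: Or44; exists p, q; split=> [|y y01]; first by constructor.
  by rewrite pE ltrD2l explt //; lia.
(* Now p < n. Either p = q = n - 1, or q <= n - 2, and then y^n < y^p and y^(n-2) <= y^q. *)
have [qE|qE] := eqVneq q n.-1.
  have pE' : p = n.-1 by lia.
  by apply: Or42; constructor; move: T; rewrite pE' qE.
apply: Or44; exists p, q; split=> [|y y01]; first by constructor.
by apply: ltr_leD; rewrite ?explt ?expl //; lia.
Qed.

End Comparison.

Theorem theorem1 (R : realType) (n : nat) (hn : (4 <= n)%N) :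
  unique_kth_minimizer R n 2 (theta 1 1 (n - 4)) /\
  unique_kth_minimizer R n 3 (theta 0 2 (n - 4)).
Proof.
(* The digraph of least spectral radius, needed to count the values below the other two. *)
have [T1] : inhabited (two_cycles (theta 0 1 (n - 3)) n.-1 n).
  by have := @theta_two_cycles 0 1 (n - 3) isT; congr (inhabited (two_cycles _ _ _)); lia.
have [T2] : inhabited (two_cycles (theta 1 1 (n - 4)) n.-1 n.-1).
  by have := @theta_two_cycles 1 1 (n - 4) isT; congr (inhabited (two_cycles _ _ _)); lia.
have [T3] : inhabited (two_cycles (theta 0 2 (n - 4)) n.-2 n).
  by have := @theta_two_cycles 0 2 (n - 4) isT; congr (inhabited (two_cycles _ _ _)); lia.
set D1 := theta 0 1 _ in T1; set D2 := theta 1 1 _ in T2 *; set D3 := theta 0 2 _ in T3 *.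
have c1 : #|D1| = n by rewrite card_theta; lia.
have c2 : #|D2| = n by rewrite card_theta; lia.
have c3 : #|D3| = n by rewrite card_theta; lia.
have b1 : bicyclic_of_order n D1 by split=> //; apply: two_cycles_bicyclic T1.
have b2 : bicyclic_of_order n D2 by split=> //; apply: two_cycles_bicyclic T2.
have b3 : bicyclic_of_order n D3 by split=> //; apply: two_cycles_bicyclic T3.
have lt12 : (spectral_radius R D1 < spectral_radius R D2)%R.
  apply: (spectral_radius_lt T1 T2) => y /andP[y0 y1].
  by rewrite ltrD2l ltr_iXn2l //; lia.
have lt23 : (spectral_radius R D2 < spectral_radius R D3)%R.
  apply: (spectral_radius_lt T2 T3) => y /andP[y0 y1].
  have [m ->] : exists m, n = m.+2 by exists n.-2; lia.
  rewrite /= !exprS; have : (0 < y ^+ m)%R by rewrite exprn_gt0.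
  move=> ym; rewrite -subr_gt0.
  (* The gap y^n + y^(n-2) - 2 y^(n-1) is y^(n-2) times a square. *)
  have -> : (y ^+ m + y * (y * y ^+ m) - (y * y ^+ m + y * y ^+ m) = y ^+ m * (1 - y) ^+ 2)%R by ring.
  by rewrite mulr_gt0 // exprn_gt0 // subr_gt0.
(* The second and third cases also record the isomorphism, from which uniqueness follows. *)
have cases D : bicyclic_of_order n D ->
  [\/ spectral_radius R D = spectral_radius R D1, spectral_radius R D = spectral_radius R D2 /\ isomorphic D D2,
      spectral_radius R D = spectral_radius R D3 /\ isomorphic D D3 | (spectral_radius R D3 < spectral_radius R D)%R].
  move=> bD; have cD : #|D| = n by case: bD.
  case: (bicyclic_cases R hn bD) => [[T]|[T]|[T]|[p [q [[T] lt]]]].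
  - by apply: Or41; apply: spectral_radius_eq (two_cycles_sym T) T1.
  - apply: Or42; split; first exact: spectral_radius_eq T T2.
    by apply: (two_cycles_isomorphic T T2); rewrite cD.
  - apply: Or43; split; first exact: spectral_radius_eq (two_cycles_sym T) T3.
    by apply: (two_cycles_isomorphic (two_cycles_sym T) T3); rewrite cD.
  - by apply: Or44; apply: spectral_radius_lt (two_cycles_sym T3) T lt.
have inS D : bicyclic_of_order n D -> spectral_radii n (spectral_radius R D) by exists D.
have [|kth2 kth3] := kth_minimum_first_three (inS _ b1) (inS _ b2) (inS _ b3) lt12 lt23.
  move=> _ [D bD <-]; case: (cases D bD) => [E1|[E2 _]|[E3 _]|lt3].
  - exact: Or41.
  - exact: Or42.
  - exact: Or43.
  - exact: Or44.
split; split.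
- by split.
(* The k-th minimum being a single value, D has the radius of [D2]; the strict inequalities leave
   only the case with the isomorphism. *)
- move=> D [bD kD]; have DD2 : spectral_radius R D = spectral_radius R D2 := kth_minimum_inj kD kth2.
  case: (cases D bD) => [DE|[_ isoD]|[DE _]|lt3] //.
  + by rewrite -DE DD2 ltxx in lt12.
  + by rewrite -DE DD2 ltxx in lt23.
  + by move: (lt_trans lt23 lt3); rewrite DD2 ltxx.
- by split.
move=> D [bD kD]; have DD3 : spectral_radius R D = spectral_radius R D3 := kth_minimum_inj kD kth3.
case: (cases D bD) => [DE|[DE _]|[_ isoD]|lt3] //.
- by move: (lt_trans lt12 lt23); rewrite -DE DD3 ltxx.
- by rewrite -DE DD3 ltxx in lt23.
- by rewrite DD3 ltxx in lt3.
Qed.
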